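(* Let $f \in \mathbb{C}[X_1,\dots,X_n]$ be a symmetric polynomial of degree $d \le n$ and let $\lambda, \mu \in \mathbb{R}$. Put $k = \max\{ \lfloor d/2 \rfloor, 2 \}$. Then $$\inf_{x \in \mathbb{H}_+^n} \bigl( \lambda \operatorname{Re}(f(x)) + \mu \operatorname{Im}(f(x)) \bigr) = \inf_{x \in (\mathbb{H}_+)_{k,k}} \bigl( \lambda \operatorname{Re}(f(x)) + \mu \operatorname{Im}(f(x)) \bigr),$$ where the infima are taken in $\mathbb{R} \cup \{-\infty\}$.
   Context: $\mathbb{H}_+ := \{ w \in \mathbb{C} : \operatorname{Im}(w) \ge 0 \}$ is the closed upper half-plane. For an integer $k \geq 0$, $$(\mathbb{H}_+)_{k,k} := \left\{ x \in \mathbb{H}_+^n : |\{x_1,\dots,x_n\} \cap \mathbb{R}| \le k \text{ and } |\{ j \in \{1,\dots,n\} : \operatorname{Im}(x_j) > 0 \}| \le k \right\},$$ i.e. points with at most $k$ distinct real coordinate values and at most $k$ coordinates (counted with repetition) in the open upper half-plane. *)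

(* Defs.v *)
From mathcomp Require Import all_boot all_order all_algebra.
From mathcomp Require Import complex.
From mathcomp Require Import classical_sets reals constructive_ereal ereal.
(* The notations of mpoly clash with those of mathcomp-analysis, hence the
   filtered import. *)
From mathcomp Require mpoly.
Import (canonicals, coercions) mpoly.

Set Implicit Arguments.
Unset Strict Implicit.
Unset Printing Implicit Defensive.

Import Order.TTheory GRing.Theory Num.Theory.

Local Open Scope classical_set_scope.
Local Open Scope ring_scope.
Local Open Scope complex_scope.

Definition upper_half_plane {R : realType} : set R[i] :=
  [set w : R[i] | 0 <= complex.Im w].

Definition upper_half_space (R : realType) (n : nat) : set ('I_n -> R[i]) :=
  [set x | forall j, upper_half_plane (x j)].

Arguments upper_half_space : clear implicits.

(* The first cardinal is that of the set of real coordinate values (undup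
   removes repetitions); the second one counts indices, i.e. coordinates with
   repetition. *)
Definition upper_half_space_kk (R : realType) (n k : nat) :
    set ('I_n -> R[i]) :=
  [set x : 'I_n -> R[i] |
    [/\ upper_half_space R n x,
        (size (undup [seq w <- codom x | w \is Num.real]) <= k)%N &
        (#|[pred j : 'I_n | (0 < complex.Im (x j))%R]| <= k)%N]].

Arguments upper_half_space_kk : clear implicits.

Definition re_im_comb (R : realType) (n : nat) (lambda mu : R)
    (f : mpoly.mpoly n R[i]) (x : 'I_n -> R[i]) : R :=
  lambda * complex.Re (mpoly.meval x f) + mu * complex.Im (mpoly.meval x f).

(* Main.v *)
Require Import Defs.
From mathcomp Require Import all_boot all_order all_algebra.
From mathcomp Require Import complex polyrcf ring lra zify.
From mathcomp Require Import classical_sets reals constructive_ereal ereal.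
From mathcomp Require Import boolp topology normedtype derive.
From mathcomp Require mpoly.
Import (canonicals, coercions) mpoly.

Import Order.TTheory GRing.Theory Num.Theory.
Import numFieldNormedType.Exports.

Local Open Scope classical_set_scope.
Local Open Scope ring_scope.
Local Open Scope complex_scope.

(* Write f in terms of the elementary symmetric polynomials e_1, ..., e_n.
   Giving e_j weight j, every monomial has weight at most d < 2(k+1), so on a
   fibre of (e_1, ..., e_k) the polynomial f is affine in the remaining e_j.
   Inside the closed upper half space such a fibre is compact because k >= 2:
   e_1 bounds the imaginary parts, and then e_1^2 - 2 e_2 the real parts.
   Take a minimizer x on the fibre that maximizes \sum_j |e_j|^2 among all
   minimizers.  If x had a family of m > k coordinates that are distinct and
   real, or all in the open half-plane, write \prod_i (T - x_i) = p q with p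
   the factor of that family.  For small real c both (p + c) q and (p - c) q
   still have all roots in the closed half-plane; they only change e_m, e_{m+1},
   ..., so x is the midpoint of a segment of minimizers, contradicting strict
   convexity. *)

(** * Perturbing the constant term of a polynomial with known roots *)

Lemma positive_lower_bound (R : realDomainType) (I : eqType) (s : seq I)
    (F : I -> R) :
  (forall i, i \in s -> 0 < F i) ->
  exists2 e, 0 < e & forall i, i \in s -> e <= F i.
Proof.
elim: s => [|i s IHs] Fpos; first by exists 1.
have [j js|e e0 eF] := IHs; first by apply: Fpos; rewrite inE js orbT.
exists (Num.min (F i) e); first by rewrite lt_min e0 Fpos ?mem_head.
move=> j; rewrite inE => /predU1P[->|/eF eFj]; first by rewrite ge_min lexx.
by rewrite ge_min eFj orbT.
Qed.

Lemma horner_prod_XsubC (R : comNzRingType) (s : seq R) (x : R) :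
  (\prod_(z <- s) ('X - z%:P)).[x] = \prod_(z <- s) (x - z).
Proof. by rewrite horner_prod; apply: eq_bigr => z _; rewrite hornerXsubC. Qed.

Lemma size_prod_XsubC_addC (R : idomainType) (s : seq R) (c : R) :
  (0 < size s)%N ->
  size (\prod_(z <- s) ('X - z%:P) + c%:P) = (size s).+1.
Proof.
move=> s0; rewrite size_polyDl size_prod_XsubC //.
by apply: leq_ltn_trans (size_polyC_leq1 c) _; rewrite ltnS.
Qed.

Lemma lead_coef_prod_XsubC_addC (R : idomainType) (s : seq R) (c : R) :
  (0 < size s)%N -> lead_coef (\prod_(z <- s) ('X - z%:P) + c%:P) = 1.
Proof.
move=> s0; rewrite lead_coefDl; last first.
  rewrite size_prod_XsubC.
  by apply: leq_ltn_trans (size_polyC_leq1 c) _; rewrite ltnS.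
exact/monicP/monic_prod_XsubC.
Qed.

(* With 2 r at most the distance between two roots, the polynomial changes sign
   on each interval ]a - r, a + r[ around a root a; a perturbation smaller than
   its values at the endpoints preserves this. *)
Lemma perturb_simple_real_roots (R : rcfType) (s : seq R) :
  uniq s -> (0 < size s)%N ->
  exists2 e : R, 0 < e & forall c, `|c| < e ->
    exists2 s', size s' = size s &
      \prod_(z <- s') ('X - z%:P) = \prod_(z <- s) ('X - z%:P) + c%:P.
Proof.
move=> s_uniq s0; set p := \prod_(z <- s) _.
have [|e e0 sep] := @positive_lower_bound R (R * R)%type
    [seq ab <- [seq (a, b) | a <- s, b <- s] | ab.1 != ab.2]
    (fun ab => `|ab.1 - ab.2|).
  by move=> ab; rewrite mem_filter => /andP[ab_neq _]; rewrite normr_gt0 subr_eq0.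
pose r := e / 2.
have r0 : 0 < r by rewrite divr_gt0.
have sepP a b : a \in s -> b \in s -> a != b -> 2 * r <= `|a - b|.
  move=> sa sb ab; rewrite /r mulrCA divff ?mulr1 ?pnatr_eq0 //.
  apply: (sep (a, b)); rewrite mem_filter ab /=.
  by apply/allpairsP; exists (a, b).
have sign a : a \in s -> p.[a - r] * p.[a + r] < 0.
  move=> sa; rewrite /p !horner_prod_XsubC -big_split /= (big_rem a) //=.
  have -> : (a - r - a) * (a + r - a) = - r ^+ 2 by ring.
  rewrite mulNr oppr_lt0 mulr_gt0 ?exprn_gt0 // big_seq prodr_gt0 // => b.
  rewrite (rem_filter _ s_uniq) mem_filter => /andP[/= ba sb].
  have := sepP _ _ sa sb; rewrite eq_sym => /(_ ba) rab.
  have -> : (a - r - b) * (a + r - b) = `|a - b| ^+ 2 - r ^+ 2.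
    by rewrite real_normK ?num_real //; ring.
  rewrite subr_gt0 ltr_pXn2r ?nnegrE // ?(ltW r0) //; lra.
have [|d d0 dP] := @positive_lower_bound R R s
    (fun a => Num.min `|p.[a - r]| `|p.[a + r]|).
  move=> a /sign; rewrite lt_min !normr_gt0 => pa.
  by rewrite -negb_or -mulf_eq0 lt_eqF.
exists d => // c cd.
(* The intermediate value theorem gives a root of the perturbed polynomial near each [a]; [0] is a
   dummy value outside [s]. *)
have /choice[t tP] a : exists t, a \in s ->
    (a - r < t < a + r) /\ root (p + c%:P) t.
  have [sa|] := boolP (a \in s); last by exists 0.
  have ar : a - r <= a + r by lra.
  have [|t t_itv ?] := @poly_ivtoo R (p + c%:P) _ _ ar; last first.
    by exists t; move: t_itv; rewrite in_itv.
  rewrite !hornerD !hornerC.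
  have := dP a sa; rewrite le_min => /andP[].
  have := sign a sa.
  move: cd; move: (p.[_]) (p.[_]) => u v; rewrite ltr_norml => /andP[cd1 cd2] uv.
  rewrite !ler_normr => /orP[] du /orP[] dv; nra.
exists (map t s); first by rewrite size_map.
have pE : size (p + c%:P) = (size (map t s)).+1.
  by rewrite size_map size_prod_XsubC_addC.
(* A monic polynomial of degree [size s] is determined by [size s] distinct roots; the [t a] are
   distinct because they lie in disjoint intervals. *)
rewrite [RHS](all_roots_prod_XsubC pE).
- by rewrite lead_coef_prod_XsubC_addC // scale1r.
- by apply/allP => _ /mapP[a /tP[_ ?] ->].
rewrite uniq_rootsE map_inj_in_uniq // => a b sa sb tab.
apply/eqP; apply/negPn/negP => ab.
have [] := (tP a sa, tP b sb) => -[+ _] [+ _]; rewrite tab.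
move=> /andP[? ?] /andP[? ?].
by have := sepP _ _ sa sb ab; rewrite ler_normr => /orP[]; lra.
Qed.

Definition perturbable (R : realType) (s : seq R[i]) :=
  exists2 e : R, 0 < e & forall c : R, `|c| < e -> exists s' : seq R[i],
    [/\ size s' = size s, (forall w, w \in s' -> upper_half_plane w) &
        \prod_(z <- s') ('X - z%:P) = \prod_(z <- s) ('X - z%:P) + (c%:C)%:P].

Lemma normc_ge_Im (R : rcfType) (x : R[i]) : `|complex.Im x|%:C <= `|x|.
Proof.
by case: x => a b; rewrite normc_def lecR -sqrtr_sqr ler_wsqrtr // lerDr sqr_ge0.
Qed.

(** Simple roots stay real under a small real shift, and the closed half-plane contains the real
    axis. Repeated roots would not do: ['X^2 + c] with [c > 0] has a root below the axis. *)
Lemma perturbable_real (R : realType) (s : seq R[i]) :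
  uniq s -> (0 < size s)%N -> (forall w, w \in s -> w \is Num.real) ->
  perturbable R s.
Proof.
move=> s_uniq s0 s_real.
have sE : s = map (real_complex R) (map (@complex.Re R) s).
  rewrite -map_comp -[LHS]map_id; apply/eq_in_map => w /s_real /= /RRe_real.
  by move=> ->.
have [||e e0 eP] := @perturb_simple_real_roots R (map (@complex.Re R) s).
- by move: s_uniq; rewrite {1}sE => /map_uniq.
- by rewrite size_map.
have map_prod (r : seq R) : \prod_(z <- map (real_complex R) r) ('X - z%:P) =
    map_poly (real_complex R) (\prod_(z <- r) ('X - z%:P)).
  rewrite rmorph_prod big_map; apply: eq_bigr => z _.
  by rewrite rmorphB /= map_polyX map_polyC.
exists e => // c /eP[s' s's s'E]; exists (map (real_complex R) s'); split.
- by rewrite size_map s's size_map.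
- by move=> _ /mapP[x _ ->]; rewrite /upper_half_plane /=.
by rewrite map_prod s'E rmorphD /= -map_prod -sE map_polyC.
Qed.

(* A root w with Im w < 0 of the perturbed polynomial would satisfy
   |c| = \prod |w - z| > \prod Im z. *)
Lemma perturbable_upper (R : realType) (s : seq R[i]) :
  (0 < size s)%N -> (forall w, w \in s -> 0 < complex.Im w) ->
  perturbable R s.
Proof.
move=> s0 sIm; exists (\prod_(z <- s) complex.Im z).
  by rewrite big_seq prodr_gt0.
move=> c c_lt; set p := \prod_(z <- s) _ + _.
have [s'] := closed_field_poly_normal p.
rewrite lead_coef_prod_XsubC_addC // scale1r => pE.
exists s'; split=> //.
  by apply/eqP; rewrite -eqSS -(size_prod_XsubC s' id) -pE size_prod_XsubC_addC.
move=> w ws'; rewrite /upper_half_plane /= leNgt; apply/negP => w_lt0.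
have : root p w by rewrite pE root_prod_XsubC.
rewrite rootE hornerD hornerC horner_prod_XsubC addr_eq0 => /eqP pw.
have : `|\prod_(z <- s) (w - z)| = `|c|%:C.
  by rewrite pw normrN; apply/eqP; rewrite eq_complex /= expr0n addr0 sqrtr_sqr !eqxx.
rewrite normr_prod => wc; suff : (\prod_(z <- s) complex.Im z)%:C <= `|c|%:C.
  by rewrite lecR leNgt c_lt.
rewrite -wc rmorph_prod /= big_seq [leRHS]big_seq; apply: ler_prod => z /sIm z0.
rewrite ler0c (ltW z0) /=; apply: le_trans (normc_ge_Im _ _).
rewrite lecR; case: w z {ws' pw wc} w_lt0 z0 => [? ?] [? ?] /= ? ?.
by rewrite ler_normr; apply/orP; right; lra.
Qed.

(** * Elementary symmetric functions of a point *)

Definition elem (R : realType) (n : nat) (j : nat) (x : 'I_n -> R[i]) : R[i] :=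
  mpoly.meval x (mpoly.mesym n R[i] j).

(** Vieta's formulas translate between a point and the polynomial whose roots are its
    coordinates. *)
Lemma coef_prod_XsubC_codom (R : realType) (n j : nat) (x : 'I_n -> R[i]) :
  (j <= n)%N ->
  (\prod_(z <- codom x) ('X - z%:P))`_(n - j) = (-1) ^+ j * elem R n j x.
Proof.
move=> jn.
have -> : codom x = [tuple x i | i < n] by rewrite /= codomE.
rewrite (mpoly.mroots_coeff [tuple x i | i < n] (Ordinal (jn : (j < n.+1)%N))).
by congr (_ * _); apply: mpoly.meval_eq => i; rewrite tnth_mktuple.
Qed.

(** Let [p] and [q] be the products over [s] and [b]. Replacing [p] by [p + c] adds [c * q] to the
    full product; as [q] is monic of degree [n - size s], the first coefficient to move is that of
    index [size s]. Opposite values of [c] give [y] and [z]. *)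
Lemma perturb_point (R : realType) (n : nat) (x : 'I_n -> R[i])
    (s b : seq R[i]) :
  upper_half_space R n x -> perm_eq (codom x) (s ++ b) -> perturbable R s ->
  exists y z, [/\ upper_half_space R n y, upper_half_space R n z,
    forall j, (j <= n)%N -> elem R n j y + elem R n j z = 2 * elem R n j x,
    forall j, (j < size s)%N -> elem R n j y = elem R n j x &
    elem R n (size s) y != elem R n (size s) x].
Proof.
move=> xH xsb [e e0 eP].
have nE : (size s + size b)%N = n.
  by rewrite -size_cat -(perm_size xsb) size_codom card_ord.
pose q : {poly R[i]} := \prod_(z <- b) ('X - z%:P).
have shift c : `|c| < e -> exists2 y, upper_half_space R n y &
    forall j, (j <= n)%N ->
      elem R n j y = elem R n j x + (-1) ^+ j * (c%:C * q`_(n - j)).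
  move=> /eP[s' [s's s'H s'E]].
  have sz : size (s' ++ b) == n by rewrite size_cat s's nE.
  (* The order of the coordinates is immaterial, since [elem] depends only on the polynomial with
     these roots. *)
  exists (tnth (Tuple sz)).
    move=> i; have /= := mem_tnth i (Tuple sz); rewrite mem_cat.
    move=> /orP[/s'H //|ib].
    have : tnth (Tuple sz) i \in codom x by rewrite (perm_mem xsb) mem_cat ib orbT.
    by move=> /codomP[k ->].
  move=> j jn; apply: (mulfI (_ : (-1) ^+ j != 0)); first by rewrite signr_eq0.
  rewrite mulrDr mulrA -expr2 sqrr_sign mul1r -!coef_prod_XsubC_codom //.
  rewrite codomE map_tnth_enum /= (perm_big _ xsb) /= !big_cat /= s'E -/q.
  by rewrite mulrDl coefD coefCM.
have c_lt : `|e / 2| < e by rewrite gtr0_norm; lra.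
have [y yH yE] := shift _ c_lt.
have [z zH zE] := shift (- (e / 2)) (etrans (congr1 (< e)%R (normrN _)) c_lt).
have sn : (size s <= n)%N by rewrite -nE leq_addr.
exists y, z; split=> // [j jn|j js|].
- by rewrite yE // zE // rmorphN /=; ring.
- have jn : (j <= n)%N := leq_trans (ltnW js) sn.
  rewrite yE // nth_default ?mulr0 ?addr0 // size_prod_XsubC.
  by rewrite -nE -addnBAC ?(ltnW js) // -add1n leq_add2r subn_gt0.
rewrite yE // -subr_eq0 addrC addKr -nE addKn.
have -> : q`_(size b) = 1.
  by have /monicP := monic_prod_XsubC b predT id; rewrite lead_coefE size_prod_XsubC.
rewrite mulr1 mulf_neq0 ?signr_eq0 //.
by rewrite -(rmorph0 (real_complex R)) (inj_eq (@complexI R)); lra.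
Qed.

(** * Symmetric polynomials in terms of the elementary ones *)

Lemma leq_mnmwgt (n : nat) (m : mpoly.multinom n) (i : 'I_n) :
  (m i * i.+1 <= mpoly.mnmwgt m)%N.
Proof. by rewrite /mpoly.mnmwgt (bigD1 i) //= leq_addr. Qed.

Lemma leq_mnmwgt2 (n : nat) (m : mpoly.multinom n) (i j : 'I_n) :
  i != j -> (m i * i.+1 + m j * j.+1 <= mpoly.mnmwgt m)%N.
Proof.
move=> ij; rewrite /mpoly.mnmwgt (bigD1 i) //= leq_add2l (bigD1 j) ?leq_addr //.
by rewrite eq_sym.
Qed.

(** Index [i] stands for the elementary symmetric polynomial of weight [i.+1], and [msize] is the
    degree plus one for nonzero [f]. So all weights are at most [k], and no index [i >= k]
    occurs. *)
Lemma symmetric_eq_low (R : realType) (n k : nat) (f : mpoly.mpoly n R[i])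
    (x y : 'I_n -> R[i]) :
  f \is mpoly.symmetric -> (mpoly.msize f <= k.+1)%N ->
  (forall j, (j <= k)%N -> elem R n j y = elem R n j x) ->
  mpoly.meval y f = mpoly.meval x f.
Proof.
move=> /mpoly.sym_fundamental[t [<- t_wgt]] f_size xy.
rewrite !mpoly.comp_mpoly_meval !mpoly.mevalE big_seq [RHS]big_seq.
apply: eq_bigr => m mt; congr (_ * _); apply: eq_bigr => i _.
rewrite !tnth_mktuple -!/(elem _ _ _ _).
have [ik|ki] := ltnP i k; first by rewrite xy.
suff -> : m i = 0%N by rewrite !expr0.
have := leq_ltn_trans (leq_mnmwgt n m i)
  (leq_trans (mpoly.mmeasure_mnm_lt _ mt) (leq_trans t_wgt f_size)).
by case: (m i) => // a; nia.
Qed.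

(** Two factors of index at least [k] have total weight at least [2 * k + 2], above the degree bound
    [2 * k + 1]. So each monomial has at most one of them, with exponent 1, and is affine in it
    while the others are frozen. *)
Lemma symmetric_affine (R : realType) (n k : nat) (f : mpoly.mpoly n R[i])
    (x y z : 'I_n -> R[i]) :
  f \is mpoly.symmetric -> (mpoly.msize f <= (2 * k).+2)%N ->
  (forall j, (j <= k)%N -> elem R n j y = elem R n j x) ->
  (forall j, (j <= n)%N -> elem R n j y + elem R n j z = 2 * elem R n j x) ->
  mpoly.meval y f + mpoly.meval z f = 2 * mpoly.meval x f.
Proof.
move=> /mpoly.sym_fundamental[t [<- t_wgt]] f_size xy xyz.
have xz j : (j <= k)%N -> (j <= n)%N -> elem R n j z = elem R n j x.
  by move=> jk /xyz; rewrite xy // => h; apply: (addrI (elem R n j x)); rewrite h; ring.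
rewrite !mpoly.comp_mpoly_meval !mpoly.mevalE -big_split mulr_sumr /=.
rewrite big_seq [RHS]big_seq; apply: eq_bigr => m mt.
rewrite -mulrDr mulrCA; congr (_ * _).
under eq_bigr do rewrite tnth_mktuple -/(elem _ _ _ _).
under [X in _ + X]eq_bigr do rewrite tnth_mktuple -/(elem _ _ _ _).
under [X in _ = _ * X]eq_bigr do rewrite tnth_mktuple -/(elem _ _ _ _).
have m_wgt : (mpoly.mnmwgt m < (2 * k).+2)%N.
  exact: leq_trans (mpoly.mmeasure_mnm_lt _ mt) (leq_trans t_wgt f_size).
have [i /andP[ki mi]|noi] := pickP [pred i : 'I_n | (k <= i)%N && (0 < m i)%N].
  have mi1 : m i = 1%N.
    have := leq_ltn_trans (leq_mnmwgt n m i) m_wgt.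
    by case: (m i) mi => [//|[//|a]]; nia.
  have low (j : 'I_n) : j != i -> (j < k)%N \/ m j = 0%N.
    move=> ji; have [jk|kj] := ltnP j k; [by left|right].
    have := leq_ltn_trans (leq_mnmwgt2 n m j i ji) m_wgt.
    by rewrite mi1; case: (m j) => // a; nia.
  have split_i (E : 'I_n -> R[i]) :
      \prod_j E j ^+ m j = E i * \prod_(j | j != i) E j ^+ m j.
    by rewrite (bigD1 i) //= mi1 expr1.
  rewrite !split_i.
  rewrite [X in _ * X + _](eq_bigr (fun j : 'I_n => elem R n j.+1 x ^+ m j)).
    rewrite [X in _ + _ * X](eq_bigr (fun j : 'I_n => elem R n j.+1 x ^+ m j)).
      by rewrite -mulrDl xyz // mulrA.
    by move=> j /low[jk|->]; rewrite ?expr0 // xz.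
  by move=> j /low[jk|->]; rewrite ?expr0 // xy.
have low (j : 'I_n) : (j < k)%N \/ m j = 0%N.
  have [jk|kj] := ltnP j k; [by left|right].
  by have := noi j; rewrite /= kj lt0n => /negbT; rewrite negbK => /eqP.
rewrite [X in X + _](eq_bigr (fun j : 'I_n => elem R n j.+1 x ^+ m j)).
  rewrite [X in _ + X](eq_bigr (fun j : 'I_n => elem R n j.+1 x ^+ m j)).
    by rewrite mulr2n mulrDl mul1r.
  by move=> j _; case: (low j) => [jk|->]; rewrite ?expr0 // xz.
by move=> j _; case: (low j) => [jk|->]; rewrite ?expr0 // xy.
Qed.

(** * Boundedness of the fibres *)

(** Being symmetric of degree at most 2, this polynomial is constant on fibres by
    [symmetric_eq_low], so its expression through [e_1] and [e_2] is never written out. *)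
Definition power_sum2 (R : realType) (n : nat) : mpoly.mpoly n R[i] :=
  \sum_(i < n) mpoly.mpolyX R[i] (mpoly.mnm1 i) ^+ 2.

Lemma power_sum2_sym (R : realType) (n : nat) :
  power_sum2 R n \is mpoly.symmetric.
Proof.
apply/mpoly.issymP => s; rewrite /power_sum2 raddf_sum /=.
rewrite [RHS](reindex_inj (@perm.perm_inj _ s)) /=; apply: eq_bigr => i _.
rewrite !mpoly.mpolyXn mpoly.msymX; congr (mpoly.mpolyX _ _).
apply/mpoly.mnmP => j; rewrite mpoly.mnmE !mpoly.mulmnE !mpoly.mnm1E.
by rewrite -[in RHS](perm.permKV s j) (inj_eq (@perm.perm_inj _ s)).
Qed.

Lemma msize_power_sum2 (R : realType) (n : nat) :
  (mpoly.msize (power_sum2 R n) <= 3)%N.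
Proof.
apply: leq_trans (mpoly.mmeasure_sum _ _ _ _) _; apply/bigmax_leqP => i _.
by rewrite mpoly.mpolyXn mpoly.msizeX mpoly.mdegMn mpoly.mdeg1.
Qed.

Lemma meval_power_sum2 (R : realType) (n : nat) (x : 'I_n -> R[i]) :
  mpoly.meval x (power_sum2 R n) = \sum_i x i ^+ 2.
Proof.
rewrite /power_sum2 raddf_sum; apply: eq_bigr => i _.
by rewrite /= !expr2 mpoly.mevalM mpoly.mevalXU.
Qed.

Lemma elem1E (R : realType) (n : nat) (x : 'I_n -> R[i]) :
  elem R n 1 x = \sum_i x i.
Proof.
rewrite /elem mpoly.mesym1E raddf_sum; apply: eq_bigr => i _.
exact: mpoly.mevalXU.
Qed.

Lemma fibre_bounded (R : realType) (n : nat) (y : 'I_n -> R[i]) :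
  exists B : R, forall x, upper_half_space R n x ->
    (forall j, (j <= 2)%N -> elem R n j x = elem R n j y) ->
    forall i, - B <= complex.Re (x i) <= B /\ 0 <= complex.Im (x i) <= B.
Proof.
pose S := complex.Im (elem R n 1 y).
pose P := complex.Re (mpoly.meval y (power_sum2 R n)).
(* [S] bounds each imaginary part and [P + S ^+ 2 *+ n] each squared real part [a ^+ 2]; the
   inequality [|a| <= 1 + a ^+ 2] then avoids a square root. *)
exists (S + (1 + `|P| + S ^+ 2 *+ n)) => x xH xy i.
have Im_le j : complex.Im (x j) <= S.
  rewrite /S -(xy 1%N) // elem1E raddf_sum /= (bigD1 j) //= lerDl.
  by apply: sumr_ge0 => l _; exact: xH.
have Im_ge j : 0 <= complex.Im (x j) by exact: xH.
have S0 : 0 <= S by apply: le_trans (Im_le i).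
have := symmetric_eq_low R n 2 _ y x (power_sum2_sym R n) (msize_power_sum2 R n) xy.
move=> /(congr1 (@complex.Re R)); rewrite -/P meval_power_sum2 raddf_sum /=.
have ReX2 (w : R[i]) : complex.Re (w ^+ 2) = complex.Re w ^+ 2 - complex.Im w ^+ 2.
  by case: w => a b; rewrite expr2 /= !expr2.
under eq_bigr do rewrite ReX2.
rewrite sumrB => /eqP; rewrite subr_eq => /eqP sumE.
have Re_le : complex.Re (x i) ^+ 2 <= P + S ^+ 2 *+ n.
  apply: (@le_trans _ _ (\sum_j complex.Re (x j) ^+ 2)).
    by rewrite (bigD1 i) //= lerDl sumr_ge0 // => l _; rewrite sqr_ge0.
  rewrite sumE lerD2l -[X in _ *+ X]card_ord -sumr_const ler_sum // => j _.
  by rewrite ler_pXn2r ?nnegrE.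
have n0 : 0 <= S ^+ 2 *+ n by rewrite mulrn_wge0 // sqr_ge0.
have := Im_le i; have := Im_ge i; have := ler_norm P; have := normr_ge0 P.
move: (complex.Re _) (complex.Im _) (`|P|) (_ *+ n) Re_le n0 => a b p t.
by move=> *; split; apply/andP; split; nra.
Qed.

(** * Continuity and compactness *)

(** Splitting into real components makes [R] the only target space whose topology is involved. *)
Definition continuous_complex (R : realType) (T : topologicalType)
    (g : T -> R[i]) :=
  continuous (fun t => complex.Re (g t)) /\
  continuous (fun t => complex.Im (g t)).

Lemma continuous_complex_cst (R : realType) (T : topologicalType) (c : R[i]) :
  continuous_complex R T (fun=> c).
Proof. by split=> t; exact: cvg_cst. Qed.

Lemma continuous_complexD (R : realType) (T : topologicalType)
    (g h : T -> R[i]) :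
  continuous_complex R T g -> continuous_complex R T h ->
  continuous_complex R T (fun t => g t + h t).
Proof.
move=> [g1 g2] [h1 h2]; split.
  under eq_fun do rewrite raddfD /=.
  by move=> t; apply: cvgD; [exact: g1|exact: h1].
under eq_fun do rewrite raddfD /=.
by move=> t; apply: cvgD; [exact: g2|exact: h2].
Qed.

Lemma continuous_complexM (R : realType) (T : topologicalType)
    (g h : T -> R[i]) :
  continuous_complex R T g -> continuous_complex R T h ->
  continuous_complex R T (fun t => g t * h t).
Proof.
move=> [g1 g2] [h1 h2].
have ReM (a b : R[i]) : complex.Re (a * b) =
  complex.Re a * complex.Re b - complex.Im a * complex.Im b by case: a; case: b.
have ImM (a b : R[i]) : complex.Im (a * b) =
  complex.Re a * complex.Im b + complex.Im a * complex.Re b by case: a; case: b.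
split.
  under eq_fun do rewrite ReM.
  move=> t; apply: cvgB; apply: cvgM;
    [exact: g1|exact: h1|exact: g2|exact: h2].
under eq_fun do rewrite ImM.
move=> t; apply: cvgD; apply: cvgM;
  [exact: g1|exact: h2|exact: g2|exact: h1].
Qed.

Lemma continuous_meval (R : realType) (T : topologicalType) (n : nat)
    (f : mpoly.mpoly n R[i]) (x : T -> 'I_n -> R[i]) :
  (forall i, continuous_complex R T (x^~ i)) ->
  continuous_complex R T (fun t => mpoly.meval (x t) f).
Proof.
move=> xc.
have sum_cont (I : Type) (s : seq I) (F : I -> T -> R[i]) :
    (forall i, continuous_complex R T (F i)) ->
    continuous_complex R T (fun t => \sum_(i <- s) F i t).
  move=> Fc; elim: s => [|i s IHs].
    by under eq_fun do rewrite big_nil; exact: continuous_complex_cst.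
  by under eq_fun do rewrite big_cons; exact: continuous_complexD.
have prod_cont (I : Type) (s : seq I) (F : I -> T -> R[i]) :
    (forall i, continuous_complex R T (F i)) ->
    continuous_complex R T (fun t => \prod_(i <- s) F i t).
  move=> Fc; elim: s => [|i s IHs].
    by under eq_fun do rewrite big_nil; exact: continuous_complex_cst.
  by under eq_fun do rewrite big_cons; exact: continuous_complexM.
under eq_fun do rewrite mpoly.mevalE.
apply: sum_cont => m; apply: continuous_complexM.
  exact: continuous_complex_cst.
apply: prod_cont => i; elim: (m i) => [|e IHe].
  by under eq_fun do rewrite expr0; exact: continuous_complex_cst.
by under eq_fun do rewrite exprS; exact: continuous_complexM.
Qed.

(** The minimizers of [F] on [K] form a closed part of a compact set, hence a compact one, on which
    [N] attains its maximum. *)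
Lemma compact_lex_extremum (R : realType) (T : topologicalType) (K : set T)
    (F N : T -> R) :
  compact K -> K !=set0 -> continuous F -> continuous N ->
  exists c, [/\ K c, forall t, K t -> F c <= F t &
    forall t, K t -> F t = F c -> N t <= N c].
Proof.
move=> Kc K0 Fc Nc.
have [c0 /set_mem Kc0 Fmin] := compact_EVT_min K0 Kc (continuous_subspaceT Fc).
have K1c : compact (K `&` F @^-1` [set F c0]).
  apply: compact_closedI => //.
  by move/continuous_closedP: Fc; apply; exact: closed_eq.
have [|c /set_mem[Kc1 Fc1] Nmax] :=
  compact_EVT_max _ K1c (continuous_subspaceT Nc); first by exists c0.
exists c; split=> // t Kt.
  by rewrite Fc1; apply: Fmin; exact: mem_set.
by move=> Ft; apply: Nmax; apply: mem_set; split; rewrite //= Ft.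
Qed.

(** Coding points by pairs of real row vectors reduces compactness to products of real segments. *)
Definition complex_point (R : realType) (n : nat)
    (v : 'rV[R]_n * 'rV[R]_n) (i : 'I_n) : R[i] :=
  v.1 ord0 i +i* v.2 ord0 i.

Lemma continuous_complex_point (R : realType) (n : nat) (i : 'I_n) :
  continuous_complex R ('rV[R]_n * 'rV[R]_n)%type (complex_point R n ^~ i).
Proof.
split=> v /=.
  by apply: (@continuous_comp _ _ _ fst (fun u : 'rV[R]_n => u ord0 i));
    [exact: cvg_fst|exact: coord_continuous].
by apply: (@continuous_comp _ _ _ snd (fun u : 'rV[R]_n => u ord0 i));
    [exact: cvg_snd|exact: coord_continuous].
Qed.

Lemma complex_point_surj (R : realType) (n : nat) (x : 'I_n -> R[i]) :
  exists v, complex_point R n v = x.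
Proof.
exists (\row_i complex.Re (x i), \row_i complex.Im (x i)).
by apply/funext => i; rewrite /complex_point !mxE; case: (x i).
Qed.

Definition fibre (R : realType) (n k : nat) (y : 'I_n -> R[i]) :
    set ('I_n -> R[i]) :=
  [set x | upper_half_space R n x /\
           forall j, (j <= k)%N -> elem R n j x = elem R n j y].

Lemma fibre_compact (R : realType) (n k : nat) (y : 'I_n -> R[i]) :
  (2 <= k)%N -> compact (complex_point R n @^-1` fibre R n k y).
Proof.
move=> k2; have [B Bbox] := fibre_bounded R n y.
pose A1 := [set u : 'rV[R]_n | forall i, `[- B, B]%classic (u ord0 i)].
pose A2 := [set u : 'rV[R]_n | forall i, `[0, B]%classic (u ord0 i)].
pose E j := [set v : 'rV[R]_n * 'rV[R]_n |
  elem R n j (complex_point R n v) = elem R n j y].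
(* The half-plane condition is absorbed by the lower bound 0 in [A2]; what remains is a box cut by
   closed equations. *)
have -> : complex_point R n @^-1` fibre R n k y =
    (A1 `*` A2) `&` \bigcap_(j in [set j | (j <= k)%N]) E j.
  apply/seteqP; split=> v.
    move=> [vH vy]; split; last by move=> j /= /vy.
    have vbox := Bbox _ vH (fun j j2 => vy j (leq_trans j2 k2)).
    by split=> i /=; rewrite in_itv /=; have [] := vbox i.
  move=> [[_ v2] vy]; split=> // i.
  by have := v2 i; rewrite /upper_half_plane /= in_itv /= => /andP[].
apply: compact_closedI.
  apply: compact_setX.
    by apply: (@rV_compact _ _ (fun=> `[- B, B]%classic)) => i; exact: segment_compact.
  by apply: (@rV_compact _ _ (fun=> `[0, B]%classic)) => i; exact: segment_compact.
apply: closed_bigI => j _.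
have [Rec Imc] : continuous_complex R _ (fun v => elem R n j (complex_point R n v)).
  by apply: continuous_meval => i; exact: continuous_complex_point.
have -> : E j =
    (fun v => complex.Re (elem R n j (complex_point R n v))) @^-1`
      [set complex.Re (elem R n j y)] `&`
    (fun v => complex.Im (elem R n j (complex_point R n v))) @^-1`
      [set complex.Im (elem R n j y)].
  apply/seteqP; split=> v; rewrite /E /=; first by move=> ->.
  move=> [].
  by case: (elem _ _ _ _) => ? ?; case: (elem _ _ _ _) => ? ? /= -> ->.
apply: closedI.
  exact: (continuous_closedP _).1 Rec _ (@closed_eq _ _).
exact: (continuous_closedP _).1 Imc _ (@closed_eq _ _).
Qed.

(** * Strict convexity and reduction on a fibre *)

Definition elem_norm2 (R : realType) (n : nat) (x : 'I_n -> R[i]) : R :=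
  \sum_(j < n.+1) (complex.Re (elem R n j x) ^+ 2 + complex.Im (elem R n j x) ^+ 2).

(** By the parallelogram identity, index [j] contributes an excess of twice the squared distance
    from [elem R n j y] to [elem R n j x], which is positive at [j = k]. *)
Lemma elem_norm2_midpoint (R : realType) (n k : nat) (x y z : 'I_n -> R[i]) :
  (forall j, (j <= n)%N -> elem R n j y + elem R n j z = 2 * elem R n j x) ->
  (k <= n)%N -> elem R n k y != elem R n k x ->
  2 * elem_norm2 R n x < elem_norm2 R n y + elem_norm2 R n z.
Proof.
move=> xyz kn kyx; rewrite /elem_norm2 mulr_sumr -big_split /=.
have mid j : (j <= n)%N ->
    2 * (complex.Re (elem R n j x) ^+ 2 + complex.Im (elem R n j x) ^+ 2) <=
    complex.Re (elem R n j y) ^+ 2 + complex.Im (elem R n j y) ^+ 2 +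
    (complex.Re (elem R n j z) ^+ 2 + complex.Im (elem R n j z) ^+ 2)
    ?= iff (elem R n j y == elem R n j x).
  move=> /xyz; case: (elem _ _ _ x) (elem _ _ _ y) (elem _ _ _ z).
  move=> a b [a1 b1] [a2 b2]; rewrite mulr_natl mulr2n => -[aE bE].
  have {aE}-> : a2 = a + a - a1 by rewrite -aE; ring.
  have {bE}-> : b2 = b + b - b1 by rewrite -bE; ring.
  have -> : a1 ^+ 2 + b1 ^+ 2 + ((a + a - a1) ^+ 2 + (b + b - b1) ^+ 2) =
    2 * (a ^+ 2 + b ^+ 2) + 2 * ((a1 - a) ^+ 2 + (b1 - b) ^+ 2) by ring.
  split; first by rewrite lerDl mulr_ge0 // addr_ge0 // sqr_ge0.
  rewrite eq_sym addrC -subr_eq0 addrK mulf_eq0 pnatr_eq0 /=.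
  by rewrite paddr_eq0 ?sqr_ge0 // !sqrf_eq0 !subr_eq0 eq_complex.
have k_ord : (k < n.+1)%N by [].
rewrite (bigD1 (Ordinal k_ord)) //= [ltRHS](bigD1 (Ordinal k_ord)) //=.
apply: ltr_leD; first by rewrite (lt_leif (mid k kn)).
by apply: ler_sum => j _; rewrite (leif_le (mid j _)) // -ltnS.
Qed.

Lemma re_im_comb_midpoint (R : realType) (n k : nat) (lambda mu : R)
    (f : mpoly.mpoly n R[i]) (x y z : 'I_n -> R[i]) :
  f \is mpoly.symmetric -> (mpoly.msize f <= (2 * k).+2)%N ->
  (forall j, (j <= k)%N -> elem R n j y = elem R n j x) ->
  (forall j, (j <= n)%N -> elem R n j y + elem R n j z = 2 * elem R n j x) ->
  re_im_comb lambda mu f y + re_im_comb lambda mu f z =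
  2 * re_im_comb lambda mu f x.
Proof.
move=> fsym f_size xy xyz.
have := symmetric_affine R n k f x y z fsym f_size xy xyz.
rewrite /re_im_comb; move: (mpoly.meval x f) (mpoly.meval y f) (mpoly.meval z f).
move=> [a b] [a1 b1] [a2 b2]; rewrite mulr_natl mulr2n => -[aE bE] /=.
have -> : a2 = a + a - a1 by rewrite -aE; ring.
have -> : b2 = b + b - b1 by rewrite -bE; ring.
ring.
Qed.

Lemma fibre_reduction (R : realType) (n k : nat) (lambda mu : R)
    (f : mpoly.mpoly n R[i]) (y : 'I_n -> R[i]) :
  (2 <= k)%N -> f \is mpoly.symmetric -> (mpoly.msize f <= (2 * k).+2)%N ->
  upper_half_space R n y ->
  exists2 x, upper_half_space_kk R n k x &
    re_im_comb lambda mu f x <= re_im_comb lambda mu f y.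
Proof.
move=> k2 fsym f_size yH; pose F := re_im_comb lambda mu f.
have pointc := continuous_complex_point R n.
have Fc : continuous (fun v => F (complex_point R n v)).
  have [Rec Imc] := continuous_meval R _ n f (complex_point R n) pointc.
  move=> v; apply: cvgD; apply: cvgM;
    [exact: cvg_cst|exact: Rec|exact: cvg_cst|exact: Imc].
have Nc : continuous (fun v => elem_norm2 R n (complex_point R n v)).
  apply: continuous_big => [|j _]; first exact: add_continuous.
  have [Rec Imc] :=
    continuous_meval R _ n (mpoly.mesym n R[i] j) (complex_point R n) pointc.
  under eq_fun do rewrite !expr2.
  move=> v; apply: cvgD; apply: cvgM;
    [exact: Rec|exact: Rec|exact: Imc|exact: Imc].
have K0 : (complex_point R n @^-1` fibre R n k y) !=set0.
  by have [v vy] := complex_point_surj R n y; exists v; rewrite /= vy.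
have [v [[xH xy] Fmin Nmax]] :=
  compact_lex_extremum R _ _ _ _ (fibre_compact R n k y k2) K0 Fc Nc.
set x := complex_point R n v in xH xy Fmin Nmax.
have {}Fmin z : fibre R n k y z -> F x <= F z.
  by have [w <-] := complex_point_surj R n z; exact: Fmin.
have {}Nmax z : fibre R n k y z -> F z = F x -> elem_norm2 R n z <= elem_norm2 R n x.
  by have [w <-] := complex_point_surj R n z; exact: Nmax.
have not_perturbable s : subseq s (codom x) -> perturbable R s -> (size s <= k)%N.
  move=> sx s_pert; rewrite leqNgt; apply/negP => ks.
  have [b xsb] := perm_to_subseq sx.
  have [y' [z' [y'H z'H mid y'x ne]]] := perturb_point R n x s b xH xsb s_pert.
  have sn : (size s <= n)%N by rewrite -[X in (_ <= X)%N](card_ord n) -(size_codom x) size_subseq.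
  have y'k j : (j <= k)%N -> elem R n j y' = elem R n j x.
    by move=> jk; apply: y'x; exact: leq_ltn_trans ks.
  have z'k j : (j <= k)%N -> elem R n j z' = elem R n j x.
    move=> jk; apply: (addrI (elem R n j y')); rewrite mid ?y'k //; first by ring.
    by apply: leq_trans sn; apply: ltnW; exact: leq_ltn_trans ks.
  have Ky : fibre R n k y y' by split=> // j jk; rewrite y'k // xy.
  have Kz : fibre R n k y z' by split=> // j jk; rewrite z'k // xy.
  have := re_im_comb_midpoint R n k lambda mu f x y' z' fsym f_size y'k mid.
  rewrite -!/(F _) => Fmid.
  have := Fmin _ Ky; have := Fmin _ Kz => Fz Fy.
  have := elem_norm2_midpoint R n _ x y' z' mid sn ne.
  (* Both values are at least [F x] and their mean is [F x], so [y'] and [z'] are minimizers too. *)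
  have Fy' : F y' = F x by lra.
  have Fz' : F z' = F x by lra.
  have := Nmax _ Ky Fy'; have := Nmax _ Kz Fz'; lra.
exists x; last exact: Fmin.
split=> //.
  (* Listing each real value once makes the roots simple, as [perturbable_real] requires; the empty
     list satisfies the bound trivially. *)
  set s := undup _; have [->//|s0] := posnP (size s).
  apply: not_perturbable.
    exact: subseq_trans (undup_subseq _) (filter_subseq _ _).
  apply: perturbable_real => //; first exact: undup_uniq.
  by move=> w; rewrite mem_undup mem_filter => /andP[].
(* Repetitions are kept here: indices are counted, and [perturbable_upper] allows multiple roots. *)
pose s := [seq w <- codom x | 0 < complex.Im w].
have -> : #|[pred j | 0 < complex.Im (x j)]| = size s.
  by rewrite /s codomE filter_map size_map cardE {1}/enum_mem -enumT.
have [->//|s0] := posnP (size s); apply: not_perturbable.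
  exact: filter_subseq.
by apply: perturbable_upper => // w; rewrite mem_filter => /andP[].
Qed.

(** * Equality of the two infima *)

Theorem theorem2p10 (R : realType) (n d : nat) (f : mpoly.mpoly n R[i])
    (lambda mu : R)
    (fsym : f \is mpoly.symmetric)
    (fdeg : (mpoly.msize f).-1 = d)
    (dn : (d <= n)%N) :
  let k := maxn (d %/ 2) 2 in
  ereal_inf [set (re_im_comb lambda mu f x)%:E | x in upper_half_space R n] =
  ereal_inf [set (re_im_comb lambda mu f x)%:E
            | x in upper_half_space_kk R n k].
Proof.
move=> k; apply/le_anti/andP; split.
  by apply: ereal_inf_le_tmp => _ [x [xH _ _] <-]; exists x.
(* The comparison is made value by value, so the infima may be infinite or not attained. *)
apply: le_ereal_inf_tmp => _ [y yH <-].
(* [msize f] is at most [d.+1], also for [f = 0] where it is 0, and [d < 2 * (d %/ 2) + 2]. *)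
have f_size : (mpoly.msize f <= (2 * k).+2)%N.
  have := divn_eq d 2; have := ltn_pmod d (isT : (0 < 2)%N).
  have := leq_maxl (d %/ 2) 2; rewrite -/k.
  move: fdeg; case: (mpoly.msize f) => //= m; lia.
have [x xkk Fxy] := fibre_reduction R n k lambda mu f y (leq_maxr _ _) fsym f_size yH.
apply: (@le_trans _ _ (re_im_comb lambda mu f x)%:E); last by rewrite lee_fin.
by apply: ereal_inf_lbound; exists x.
Qed.
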